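(* Let $\mathcal{X}$ (states) and $\mathcal{A}$ (control actions) be sets, $K\ge 1$ an integer, $x_1\in\mathcal{X}$ given, $h_k:\mathcal{X}\times\mathcal{A}\to\mathcal{X}$ and $r_k:\mathcal{X}\times\mathcal{A}\to\mathbb{R}_+$ for $k=1,\ldots,K$, and let $W_{k+1}:\mathcal{X}\times\mathcal{A}\to\mathbb{R}$, $k=1,\ldots,K$, be functions with $W_{K+1}\equiv 0$. Let $\mathcal{A}_K$ be the set of strings over $\mathcal{A}$ of length at most $K$ and define $f$ on $\mathcal{A}_K$ by $f(\varnothing)=0$ and, for $1\le k\le K$, $$f((a_1,\ldots,a_k))=\sum_{i=1}^k r_i(x_i,a_i)+W_{k+1}(x_k,a_k),\qquad x_{i+1}=h_i(x_i,a_i),\ 1\le i\le k-1,$$ where $f$ is assumed to take values in $\mathbb{R}_+$. Let $(\hat a_1,\ldots,\hat a_K)$ be generated by the ADP scheme: $\hat x_1=x_1$ and, for $k=1,\ldots,K$, $$\hat a_k\in\operatorname{argmax}_{a\in\mathcal{A}}\{r_k(\hat x_k,a)+W_{k+1}(\hat x_k,a)\},\qquad \hat x_{k+1}=h_k(\hat x_k,\hat a_k).$$ Then $(\hat a_1,\ldots,\hat a_K)$ is a greedy strategy for the string-optimization problem of maximizing $f((a_1,\ldots,a_K))$ subject to $(a_1,\ldots,a_K)\in\mathcal{A}_K$.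
   Context: Strings over $\mathcal{A}$ are finite sequences of elements of $\mathcal{A}$; $\varnothing$ is the empty string; $\mathbb{R}_+$ denotes the nonnegative reals. A string $(g_1,\ldots,g_K)$ is called a greedy strategy for maximizing $f$ if for every $k=1,\ldots,K$, $g_k\in\operatorname{argmax}_{g\in\mathcal{A}} f((g_1,\ldots,g_{k-1},g))$. The function $W_{k+1}$ is the value-to-go approximation used by the approximate dynamic programming (ADP) scheme. *)

(* Defs.v *)
From mathcomp Require Import all_boot all_order all_algebra.
From mathcomp Require Import classical_sets reals.

Set Implicit Arguments.
Unset Strict Implicit.
Unset Printing Implicit Defensive.

Import Order.TTheory GRing.Theory Num.Theory.
Local Open Scope classical_set_scope.
Local Open Scope ring_scope.

(* Stages are numbered from 1: [h k], [r k] with [1 <= k <= K] and [W k.+1]    *)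
(* are the data of stage [k]; the values of these families at other indices    *)
(* are irrelevant.  The string (a_1, ..., a_K) is a tuple [a] whose entry at   *)
(* [i : 'I_K] is a_(i+1).                                                      *)

Definition argmax (T : Type) (R : realType) (f : T -> R) : set T :=
  [set x | forall y, f y <= f x].

(* [f] is only evaluated at strings of length at most [K], so its values on    *)
(* longer strings play no role.                                                *)
Definition greedy (A : Type) (R : realType) (K : nat) (f : seq A -> R)
    (g : K.-tuple A) : Prop :=
  forall i : 'I_K, argmax (fun a => f (rcons (take i g) a)) (tnth g i).

(* [state h x1 a k] is x_k for k >= 1, with controls a_1 = a 1, a_2 = a 2, ... *)
(* The value x_1 at k = 0 is a dummy.                                          *)
Fixpoint state (X A : Type) (h : nat -> X -> A -> X) (x1 : X) (a : nat -> A)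
    (k : nat) : X :=
  match k with
  | 0 => x1
  | j.+1 => if j is 0 then x1 else h j (state h x1 a j) (a j)
  end.

(* In the nonempty case the default value [a0] of [nth] is never reached.      *)
Definition objective (X A : Type) (R : realType) (h : nat -> X -> A -> X)
    (r W : nat -> X -> A -> R) (x1 : X) (s : seq A) : R :=
  match s with
  | [::] => 0
  | a0 :: _ =>
      let k := size s in
      let a := fun i => nth a0 s i.-1 in
      let x := state h x1 a in
      \sum_(1 <= i < k.+1) r i (x i) (a i) + W k.+1 (x k) (a k)
  end.

Definition adp_scheme (X A : Type) (R : realType) (K : nat)
    (h : nat -> X -> A -> X) (r W : nat -> X -> A -> R) (x1 : X)
    (xhat : nat -> X) (ahat : K.-tuple A) : Prop :=
  xhat 1%N = x1 /\
  forall i : 'I_K, let k := i.+1 in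
    argmax (fun a => r k (xhat k) a + W k.+1 (xhat k) a) (tnth ahat i) /\
    xhat k.+1 = h k (xhat k) (tnth ahat i).

(* Main.v *)
(* With the prefix (ahat_1, ..., ahat_(k-1)) fixed, the rewards of the earlier
   stages do not depend on the last control a, and the state reached at stage k
   is xhat_k; hence f at the extended string is a constant plus
   r_k(xhat_k, a) + W_(k+1)(xhat_k, a), which ahat_k maximizes. *)
Require Import Defs.
From mathcomp Require Import all_boot all_order all_algebra.
From mathcomp Require Import classical_sets reals.

Import Order.TTheory GRing.Theory Num.Theory.
Local Open Scope ring_scope.

Lemma eq_state (X A : Type) (h : nat -> X -> A -> X) (x1 : X) (a b : nat -> A)
    (k : nat) :
  (forall i, (0 < i < k)%N -> a i = b i) -> state h x1 a k = state h x1 b k.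
Proof.
elim: k => [//|[//|k] IHk] eq_ab; apply: (congr2 (h k.+1)); last by rewrite eq_ab ?ltnSn.
by apply: IHk => i /andP[i_gt0 lt_ik]; rewrite eq_ab // i_gt0 ltnW.
Qed.

(** [objective] takes its default from the head of the string, which is [b] itself when [s] is
    empty. With a fixed default [d], the sum and the state on the right are visibly free of [b]. *)
Lemma objective_rcons (X A : Type) (R : realType) (h : nat -> X -> A -> X)
    (r W : nat -> X -> A -> R) (x1 : X) (d : A) (s : seq A) (b : A) :
  let a i := nth d s i.-1 in
  let k := (size s).+1 in
  let x := state h x1 a in
  objective h r W x1 (rcons s b) =
  \sum_(1 <= i < k) r i (x i) (a i) + (r k (x k) b + W k.+1 (x k) b).
Proof.
move=> a k x.
(* [objective] reduces only on a cons; [c] is the head of [rcons s b]. *)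
have [c ->] : exists c, objective h r W x1 (rcons s b) =
    let a' i := nth c (rcons s b) i.-1 in
    let x' := state h x1 a' in
    \sum_(1 <= i < k.+1) r i (x' i) (a' i) + W k.+1 (x' k) (a' k).
  rewrite /k -(size_rcons s b).
  by case: (rcons s b) (size_rcons s b) => [|c t] // _; exists c.
set a' := fun i => nth c (rcons s b) i.-1; cbv zeta; set x' := state h x1 a'.
have eq_a i : (0 < i < k)%N -> a' i = a i.
  case: i => [//|i] lt_ik.
  by rewrite /a' /a nth_rcons /= ifT //; apply: set_nth_default.
(* Here [i = k] is allowed, although [a'] and [a] may differ there: the state at [k] uses only
   earlier controls. *)
have eq_x i : (i <= k)%N -> x' i = x i.
  move=> le_ik; apply: eq_state => j /andP[j_gt0 lt_ji].
  by rewrite eq_a // j_gt0 (leq_trans lt_ji).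
have a'k : a' k = b by rewrite /a' /k nth_rcons /= ltnn eqxx.
rewrite big_nat_recr //= eq_x // a'k addrA; congr (_ + _ + _).
apply: eq_big_nat => i /andP[i_gt0 lt_ik].
by rewrite eq_x ?eq_a ?i_gt0 // ltnW.
Qed.

(** Both sequences start from [x1] and obey the same recursion; the shift to [k.+1] starts the
    induction at stage 1. *)
Lemma adp_scheme_state (X A : Type) (R : realType) (K : nat)
    (h : nat -> X -> A -> X) (r W : nat -> X -> A -> R) (x1 : X)
    (xhat : nat -> X) (ahat : K.-tuple A) (d : A) (k : nat) :
  adp_scheme h r W x1 xhat ahat -> (k <= K)%N ->
  state h x1 (fun i => nth d ahat i.-1) k.+1 = xhat k.+1.
Proof.
move=> [xhat1 adp]; elim: k => [//|k IHk] lt_kK.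
have [_ ->] := adp (Ordinal lt_kK).
by rewrite (tnth_nth d) -IHk // ltnW.
Qed.

Theorem proposition1 (R : realType) (X A : Type) (K : nat) (hK : (1 <= K)%N)
    (x1 : X) (h : nat -> X -> A -> X) (r W : nat -> X -> A -> R)
    (r_ge0 : forall k x a, (1 <= k <= K)%N -> 0 <= r k x a)
    (W_last : forall x a, W K.+1 x a = 0)
    (f_ge0 : forall s : K.-bseq A, 0 <= objective h r W x1 s)
    (xhat : nat -> X) (ahat : K.-tuple A)
    (hadp : adp_scheme h r W x1 xhat ahat) :
  greedy (objective h r W x1) ahat.
Proof.
(* [A] is a bare type, so its default element is taken from [ahat]. *)
move=> i b; set d := tnth ahat i.
have sz : size (take i ahat) = i by rewrite size_takel // size_tuple ltnW.
have x_i : state h x1 (fun j => nth d (take i ahat) j.-1) i.+1 = xhat i.+1.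
  rewrite -(adp_scheme_state _ _ _ _ _ _ _ _ _ _ d i hadp (ltnW (ltn_ord i))).
  (* The state at [i.+1] involves only the first [i] controls, which [take i ahat] keeps. *)
  by apply: eq_state => -[//|j] lt_ji; rewrite nth_take.
rewrite !(objective_rcons _ _ _ _ _ _ _ d) !sz x_i lerD2l.
by have [max_i _] := hadp.2 i; apply: max_i.
Qed.
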